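(* Let $C>2$ be the number of classes, $Y=\{1,\dots,C\}$, and define $$b_C:=\frac{1}{1-\sqrt{\frac{C-2}{2(C-1)}}}.$$ Assume that $\|x\|\le M$ for all $x\in X\subset\mathbb R^d$, and consider the linear hypotheses $h_W(x)=Wx$ with $W\in\mathbb R^{C\times d}$ (identified with $W$). For a sample $S=\{(x_i,y_i)\}_{i=1}^n$ let $$\mu^{\mathrm{unh}}_S:=\frac1n\sum_{i=1}^nc_{y_i}x_i^\top\in\mathbb R^{C\times d},$$ where $c_y\in\mathbb R^C$ is the column vector whose $y$-th entry is $\frac{C-1}{C}$ and whose other entries are $\frac{-1}{C}$. Given a distribution $D$ over $X\times Y$, a probability of corruption $p\in[0,1)$ and a confidence parameter $\delta\in(0,1]$, with probability at least $1-\delta$ over the choice of $\overline S\sim\overline D^n$, where $\overline D$ is the distribution obtained from $D$ by uniform label noise with probability of corruption $p$, we have $$L^{0\text{-}1}_D(\mu^{\mathrm{unh}}_{\overline S})\le b_C\bigg[1-\sqrt{\frac{C}{C-1}}\,\frac{\|\mu^{\mathrm{unh}}_{\overline S}\|}{(1-p)M}\bigg]+\tilde O\bigg(\frac{b_C\sqrt{dC}}{(1-p)\sqrt n}\bigg).$$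
   Context: Uniform label noise: a pair drawn from $\overline D$ is obtained by drawing $(x,y)\sim D$ and, independently, keeping the label $y$ with probability $1-p$ and replacing it with probability $p$ by a label drawn uniformly from all of $\{1,\dots,C\}$. Equivalently, for every loss $L$, $L_{\overline D}(h)=(1-p)L_D(h)+\frac pC\,\mathbb E_{x\sim D_x}\sum_{y=1}^CL(h(x),y)$, where $L_D(h)=\mathbb E_{(x,y)\sim D}L(h(x),y)$ and $D_x$ is the marginal of $D$ on $X$. The 0-1 loss is $L^{0\text{-}1}(z,y)=1$ if there is $k\ne y$ with $z_k\ge z_y$, and $0$ otherwise; $L^{0\text{-}1}_D(W):=\mathbb E_{(x,y)\sim D}L^{0\text{-}1}(Wx,y)$. $\|\cdot\|$ on matrices is the Frobenius norm. The notation $\tilde O(q)$ stands for a quantity bounded by $K\,q$ times a fixed power of a logarithmic factor of the form $1+\ln(ndC/\delta)$, with $K$ an absolute constant (independent of $n,d,C,p,\delta,M,D$). *)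

(* Defs.v *)
From HB Require Import structures.
From mathcomp Require Import all_boot all_order all_algebra.
From mathcomp Require Import all_classical all_reals all_analysis.

Set Implicit Arguments.
Unset Strict Implicit.
Unset Printing Implicit Defensive.

Import Order.TTheory GRing.Theory Num.Theory.
Import numFieldNormedType.Exports.

Local Open Scope classical_set_scope.
Local Open Scope ring_scope.

(* Matrices (hence vectors) carry the Borel sigma-algebra. *)
HB.instance Definition _ (R : realType) (m n : nat) :=
  @isMeasurable.Build (sigma_display (@open 'M[R]_(m, n))) 'M[R]_(m, n)
    <<s @open 'M[R]_(m, n) >>
    (@sigma_algebra0 _ setT (@open 'M[R]_(m, n))) (@sigma_algebraC _ _)
    (@sigma_algebra_bigcup _ setT (@open 'M[R]_(m, n))).

(* Measurable types must be pointed, so the finite set of labels is discrete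
   measurable only in the form 'I_c.+1. *)
HB.instance Definition _ (c : nat) := isPointed.Build 'I_c.+1 ord0.
HB.instance Definition _ (c : nat) :=
  @isMeasurable.Build default_measure_display 'I_c.+1
    discrete_measurable discrete_measurable0
    discrete_measurableC discrete_measurableU.

(* [`|A|] is the sup norm on matrices in the library. *)
Definition frobenius (R : realType) (m n : nat) (A : 'M[R]_(m, n)) : R :=
  Num.sqrt (\sum_i \sum_j A i j ^+ 2).

Section iid_sample.
Context {d : measure_display} {T : measurableType d} {R : realType}.

Definition cons_pair (n : nat) (z : T * n.-tuple T) : n.+1.-tuple T :=
  [tuple of z.1 :: z.2].

Lemma measurable_cons_pair (n : nat) : measurable_fun setT (@cons_pair n).
Proof. exact: measurable_cons measurable_fst measurable_snd. Qed.

HB.instance Definition _ (n : nat) :=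
  isMeasurableFun.Build _ _ _ _ (@cons_pair n) (@measurable_cons_pair n).

(* The law D^n of n independent draws from D. *)
Fixpoint iid (D : probability T R) (n : nat) : probability (n.-tuple T) R :=
  if n is m.+1 then distribution (D \x iid D m)%E (@cons_pair m)
  else \d_([tuple] : 0.-tuple T).

End iid_sample.

Section label_noise.
Context {d : measure_display} {T : measurableType d} {R : realType}.

(* The Dirac mass is the default of [mnormalize]; it is not used, since the
   total mass is c.+1. *)
Definition uniform_label (c : nat) : probability 'I_c.+1 R :=
  mnormalize counting \d_(ord0 : 'I_c.+1).

Definition relabel (c : nat) (w : T * 'I_c.+1 * bool * 'I_c.+1) : T * 'I_c.+1 :=
  (w.1.1.1, if w.1.2 then w.2 else w.1.1.2).

Lemma measurable_relabel (c : nat) : measurable_fun setT (@relabel c).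
Proof.
apply: measurable_fun_pair => /=.
  exact: measurableT_comp measurable_fst
    (measurableT_comp measurable_fst measurable_fst).
apply: measurable_fun_ifT => /=.
- exact: measurableT_comp measurable_snd measurable_fst.
- exact: measurable_snd.
- exact: measurableT_comp measurable_snd
    (measurableT_comp measurable_fst measurable_fst).
Qed.

HB.instance Definition _ (c : nat) :=
  isMeasurableFun.Build _ _ _ _ (@relabel c) (@measurable_relabel c).

(* The coin decides with probability p that the label is redrawn; this is
   meant for 0 <= p <= 1, outside of which [bernoulli_prob] is \d_false. *)
Definition noisy (c : nat) (p : R) (D : probability (T * 'I_c.+1)%type R) :
    probability (T * 'I_c.+1)%type R :=
  distribution (D \x bernoulli_prob p \x uniform_label c)%E (@relabel c).

End label_noise.

Section classification.
Context {R : realType} {C d : nat}.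

Definition loss01 (z : 'cV[R]_C) (y : 'I_C) : R :=
  [exists k, (k != y) && (z y ord0 <= z k ord0)]%:R.

Definition label_vec (y : 'I_C) : 'cV[R]_C :=
  \col_k (if k == y then (C%:R - 1) / C%:R else - 1 / C%:R).

Definition mu_unh (n : nat) (S : n.-tuple ('cV[R]_d * 'I_C)) : 'M[R]_(C, d) :=
  n%:R^-1 *: \sum_(i < n) label_vec (tnth S i).2 *m (tnth S i).1^T.

End classification.

Definition risk01 (R : realType) (c d : nat)
    (D : probability ('cV[R]_d * 'I_c.+1)%type R) (W : 'M[R]_(c.+1, d)) :
    \bar R :=
  'E_D[fun z => loss01 (W *m z.1) z.2].

Definition b_ (R : realType) (C : nat) : R :=
  1 / (1 - Num.sqrt ((C%:R - 2) / (2 * (C%:R - 1)))).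

(* Main.v *)
Require Import Defs.
From mathcomp Require Import all_boot all_order all_algebra finmap.
From mathcomp Require Import all_classical all_reals all_analysis.
From mathcomp Require Import measurable_realfun ring lra.

(* If [z y] is not the strict maximum of [z], then [z] makes an angle with
   [c_y] whose cosine is at most the number sigma with [b_C = 1 / (1 - sigma)];
   hence L01(z, y) <= b_C * (1 - <c_y, z> / (|c_y| * |z|)).  Averaging this over
   [z = W x] bounds the risk of W by an affine function of <W, E_D c_y x^T>.
   Since the vectors [c_y] sum to 0, uniform noise multiplies E_D c_y x^T by
   1 - p, so that W = mu_unh S is, up to the fluctuations of an empirical mean,
   (1 - p) E_D c_y x^T, and <W, E_D c_y x^T> is about |W|^2 / (1 - p).  The
   fluctuations are controlled entrywise, by exponential moments and a union
   bound over the d C entries. *)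

Import Order.TTheory GRing.Theory Num.Theory.
Import numFieldNormedType.Exports.

Local Open Scope classical_set_scope.
Local Open Scope ring_scope.

(** * Measurability of the sample mean, of the loss and of the risk *)

Lemma measurable_mx_coord (R : realType) (m n : nat) i j :
  measurable_fun setT (fun A : 'M[R]_(m, n) => A i j).
Proof.
apply: (measurability _ (measurable_realfun.RGenOInfty.measurableE R)) => _ [_ [a ->] <-].
rewrite setTI; apply: sub_sigma_algebra.
apply: open_comp => [A _|]; first exact: coord_continuous.
exact: interval_open.
Qed.

Lemma measurable_discrete (c : nat) d (T : measurableType d) (f : 'I_c.+1 -> T) :
  measurable_fun setT f.
Proof. by []. Qed.

Lemma measurable_existsb d (T : measurableType d) (I : finType)
    (P : I -> T -> bool) :
  (forall i, measurable_fun setT (P i)) ->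
  measurable_fun setT (fun t => [exists i, P i t]).
Proof.
move=> mP.
have -> : (fun t => [exists i, P i t]) = (fun t => \big[orb/false]_i P i t).
  by apply/funext => t; rewrite big_orE.
elim: (index_enum I) => [|i s ih].
  by rewrite [X in measurable_fun _ X](_ : _ = cst false);
    last by apply/funext => t; rewrite big_nil.
under eq_fun do rewrite big_cons.
exact: measurable_or.
Qed.

Lemma label_vecE (R : realType) (C : nat) (y k : 'I_C) :
  @label_vec R C y k ord0 = (k == y)%:R - C%:R^-1.
Proof.
have C0 : C%:R != 0 :> R by rewrite pnatr_eq0; case: (C) k => [[]|].
rewrite mxE; case: eqP => _; last by rewrite sub0r mulNr mul1r.
by rewrite mulrBl divff // mul1r.
Qed.

(** Entry [(k, j)] of c_y x^T at z = (x, y); the concentration and the risk bound meet in the means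
    of these scalar variables. *)
Definition contrib (R : realType) (C d : nat) (k : 'I_C) (j : 'I_d)
  (z : 'cV[R]_d * 'I_C) : R := label_vec z.2 k ord0 * z.1 j ord0.

Lemma mu_unhE (R : realType) (C d n : nat) (S : n.-tuple ('cV[R]_d * 'I_C)) k j :
  mu_unh S k j = n%:R^-1 * \sum_(i < n) contrib R C d k j (tnth S i).
Proof.
rewrite /mu_unh mxE summxE; congr (_ * _); apply: eq_bigr => i _.
by rewrite /contrib mxE big_ord1 !mxE.
Qed.

Lemma measurable_contrib (R : realType) (c d : nat) k j :
  measurable_fun setT (contrib R c.+1 d k j).
Proof.
apply: measurable_funM.
  exact: (measurableT_comp (measurable_discrete c _ _
    (fun y => @label_vec R c.+1 y k ord0)) measurable_snd).
exact: (measurableT_comp (measurable_mx_coord R d 1 j ord0) measurable_fst).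
Qed.

Lemma measurable_mu_unh (R : realType) (c d n : nat) k j :
  measurable_fun setT
    (fun S : n.-tuple ('cV[R]_d * 'I_c.+1)%type => mu_unh S k j).
Proof.
under eq_fun do rewrite mu_unhE.
apply: measurable_funM => //; apply: measurable_sum => i.
apply: (@measurableT_comp _ _ _ _ _ _ (contrib R c.+1 d k j) _
  (fun S => tnth S i)); first exact: measurable_contrib.
exact: measurable_tnth.
Qed.

Lemma measurable_frobenius_mu_unh (R : realType) (c d n : nat) :
  measurable_fun setT
    (fun S : n.-tuple ('cV[R]_d * 'I_c.+1)%type => frobenius (mu_unh S)).
Proof.
rewrite /frobenius.
apply: (@measurableT_comp _ _ _ _ _ _ (@Num.sqrt R)).
  by apply: continuous_measurable_fun; exact: sqrt_continuous.
apply: measurable_sum => k; apply: measurable_sum => j.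
apply: (@measurableT_comp _ _ _ _ _ _ (fun x : R => x ^+ 2)) => //.
exact: measurable_mu_unh.
Qed.

(** The matrix may vary with [t], which gives joint measurability in the sample and a fresh pair, as
    Tonelli requires, as well as the case of a fixed matrix. *)
Lemma measurable_loss01 (R : realType) (c d d' : _) (T : measurableType d')
  (F : T -> 'M[R]_(c.+1, d)) (x : T -> 'cV[R]_d) (y : T -> 'I_c.+1) :
  (forall k j, measurable_fun setT (fun t => F t k j)) ->
  measurable_fun setT x -> measurable_fun setT y ->
  measurable_fun setT (fun t => loss01 (F t *m x t) (y t)).
Proof.
move=> mF mx my.
have mz k : measurable_fun setT (fun t => (F t *m x t) k ord0).
  under eq_fun do rewrite mxE.
  apply: measurable_sum => j; apply: measurable_funM => //.
  exact: (measurableT_comp (measurable_mx_coord R d 1 j ord0) mx).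
have mzy : measurable_fun setT (fun t => (F t *m x t) (y t) ord0).
  (* The row index depends on [t]; a sum over all rows weighted by indicators separates the index
     from the entry. *)
  have -> : (fun t => (F t *m x t) (y t) ord0) =
      (fun t => \sum_l (F t *m x t) l ord0 * (l == y t)%:R).
    apply/funext => t; rewrite (bigD1 (y t)) //= eqxx mulr1 big1 ?addr0 // => l.
    by move=> /negbTE ->; rewrite mulr0.
  apply: measurable_sum => l; apply: measurable_funM => //.
  exact: (measurableT_comp (measurable_discrete c _ _ (fun v => (l == v)%:R : R)) my).
pose E t :=
  [exists k, (k != y t) && ((F t *m x t) (y t) ord0 <= (F t *m x t) k ord0)].
have mE : measurable_fun setT E.
  apply: measurable_existsb => k; apply: measurable_and.
    exact: (measurableT_comp (measurable_discrete c _ _ (fun v => k != v)) my).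
  exact: measurable_fun_ler.
by apply: (@measurableT_comp _ _ _ _ _ _ (fun b : bool => b%:R : R) _ E).
Qed.

Lemma measurable_risk01_mu_unh (R : realType) (c d n : nat)
    (D : probability ('cV[R]_d * 'I_c.+1)%type R) :
  measurable_fun setT
    (fun S : n.-tuple ('cV[R]_d * 'I_c.+1)%type => risk01 D (mu_unh S)).
Proof.
rewrite /risk01 unlock.
pose f (w : n.-tuple ('cV[R]_d * 'I_c.+1)%type * ('cV[R]_d * 'I_c.+1)%type) :=
  (loss01 (mu_unh w.1 *m w.2.1) w.2.2)%:E.
apply: (measurable_fun_fubini_tonelli_F (m2 := D) f) => [|w]; last first.
  by rewrite lee_fin /loss01 ler0n.
apply/measurable_EFinP; apply: measurable_loss01 => [k j||].
- exact: (measurableT_comp (measurable_mu_unh R c d n k j) measurable_fst).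
- exact: (measurableT_comp measurable_fst measurable_snd).
- exact: (measurableT_comp measurable_snd measurable_snd).
Qed.

(** * Integration under uniform label noise and under independent sampling *)

Lemma ge0_integral_ord (R : realType) (c : nat)
    (P : {measure set 'I_c.+1 -> \bar R}) (h : 'I_c.+1 -> R) :
  (forall y, 0 <= h y) ->
  (\int[P]_y (h y)%:E = \sum_y (h y)%:E * P [set y])%E.
Proof.
move=> h0.
under eq_integral => y _.
  have -> : (h y)%:E = (\sum_l (h l)%:E * (\1_[set l] y)%:E)%E.
    rewrite (bigD1 y) //= indicE mem_set // mule1 big1 ?adde0 // => l ly.
    by rewrite indicE memNset ?mule0 // => /= yl; rewrite yl eqxx in ly.
  over.
rewrite ge0_integral_sum //; last first.
  by move=> l y _; rewrite mule_ge0 // lee_fin.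
apply: eq_bigr => l _.
by rewrite ge0_integralZl_EFin // integral_indic ?setIT // => y _; rewrite lee_fin.
Qed.

Lemma counting_finset (R : realType) (I : finType) (A : {pred I}) :
  counting [set x | x \in A] = (#|A|%:R : R)%:E.
Proof.
have -> : [set x | x \in A] = [set` [fset x in A]%fset].
  by apply/seteqP; split=> x /=; rewrite inE.
rewrite /counting; case: asboolP => [_|[]]; last exact: finite_fset.
by rewrite set_fsetK card_finset.
Qed.

Lemma uniform_label_set1 (R : realType) (c : nat) (y : 'I_c.+1) :
  uniform_label c [set y] = (c.+1%:R^-1 : R)%:E.
Proof.
have cT : counting [set: 'I_c.+1] = (c.+1%:R : R)%:E.
  have -> : [set: 'I_c.+1] = [set x | x \in 'I_c.+1] by apply/seteqP; split.
  by rewrite counting_finset card_ord.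
have c1 : counting [set y] = (1 : R)%:E.
  have -> : [set y] = [set x | x \in pred1 y].
    by apply/seteqP; split=> x /= /eqP.
  by rewrite counting_finset card1.
rewrite /uniform_label /= /mnormalize /= cT /= eqe pnatr_eq0 /=.
by rewrite [X in (X * _)%E]c1 mul1e.
Qed.

Lemma integral_uniform_label (R : realType) (c : nat) (h : 'I_c.+1 -> R) :
  (forall y, 0 <= h y) ->
  (\int[uniform_label c]_y (h y)%:E = (c.+1%:R^-1 * \sum_y h y)%:E)%E.
Proof.
move=> h0; rewrite ge0_integral_ord // mulr_sumr -sumEFin.
by apply: eq_bigr => y _; rewrite [X in (_ * X)%E](uniform_label_set1 R c y) -EFinM mulrC.
Qed.

(** The noisy law is the image of a product law: Tonelli integrates out the redrawn label first,
    then the coin. Both integrals may be infinite. *)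
Lemma integral_noisy (R : realType) (d : measure_display) (T : measurableType d)
    (c : nat) (p : R) (D : probability (T * 'I_c.+1)%type R)
    (h : T * 'I_c.+1 -> R) :
  0 <= p <= 1 -> measurable_fun setT h -> (forall z, 0 <= h z) ->
  (\int[noisy p D]_z (h z)%:E =
   \int[D]_z ((1 - p) * h z + p * (c.+1%:R^-1 * \sum_y h (z.1, y)))%:E)%E.
Proof.
move=> p01 mh h0.
pose f w := (h (@relabel _ T c w))%:E.
have mf : measurable_fun setT f.
  by apply/measurable_EFinP; exact: (measurableT_comp mh (@measurable_relabel _ T c)).
have f0 w : (0 <= f w)%E by rewrite lee_fin.
rewrite ge0_integral_distribution //=; last exact/measurable_EFinP.
pose Q : probability (T * 'I_c.+1 * bool)%type R := (D \x bernoulli_prob p)%E.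
have H1 := fubini_tonelli1 (m1 := Q) (m2 := uniform_label c) f mf f0.
etransitivity; first exact: H1.
have mF : measurable_fun setT (fubini_F (uniform_label c) f).
  exact: measurable_fun_fubini_tonelli_F.
have F0 w : (0 <= fubini_F (uniform_label c) f w)%E by exact: integral_ge0.
have H2 := fubini_tonelli1 (m1 := D) (m2 := bernoulli_prob p) _ mF F0.
etransitivity; first exact: H2.
apply: eq_integral => z _; rewrite /fubini_F /= integral_bernoulli_prob //;
  last by move=> b; exact: integral_ge0.
rewrite !integral_uniform_label // /relabel /=.
(* When the coin keeps the label, the average over the redrawn label is that of a constant. *)
rewrite sumr_const card_ord -!EFinM -EFinD; congr (_%:E).
rewrite -surjective_pairing /unstable.onem -[h z *+ _]mulr_natl mulKf ?pnatr_eq0 //.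
by rewrite addrC.
Qed.

(** Independence turns the mean of a product into a product of means; the induction splits off the
    first draw. *)
Lemma integral_iid (R : realType) (d : measure_display) (T : measurableType d)
    (D : probability T R) (n : nat) (h : T -> R) :
  measurable_fun setT h -> (forall z, 0 <= h z) ->
  (\int[iid D n]_S (\prod_(i < n) h (tnth S i))%:E =
   (\int[D]_z (h z)%:E) ^+ n)%E.
Proof.
move=> mh h0.
have mprod n' : measurable_fun setT
    (fun S : n'.-tuple T => (\prod_(i < n') h (tnth S i))%:E).
  apply/measurable_EFinP; apply: measurable_prod => i _.
  by apply: (measurableT_comp mh); exact: measurable_tnth.
have prod0 n' (S : n'.-tuple T) : (0 <= (\prod_(i < n') h (tnth S i))%:E)%E.
  by rewrite lee_fin prodr_ge0.
elim: n => [|n ih].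
  rewrite expe0 /= integral_dirac //; last exact: (mprod 0).
  by rewrite [X in (X * _)%E]diracT mul1e big_ord0.
pose Q : probability (T * n.-tuple T)%type R := (D \x iid D n)%E.
etransitivity.
  exact: (ge0_integral_distribution (P := Q) (@cons_pair _ T n) (mprod n.+1)
    (prod0 n.+1)).
pose f (w : T * n.-tuple T) := (\prod_(i < n.+1) h (tnth (cons_pair w) i))%:E.
have fE w : f w = ((h w.1)%:E * (\prod_(i < n) h (tnth w.2 i))%:E)%E.
  rewrite /f big_ord_recl -EFinM; congr (_ * _)%:E.
  by apply: eq_bigr => i _; rewrite tnthS.
have mf : measurable_fun setT f.
  exact: (measurableT_comp (mprod n.+1) (@measurable_cons_pair _ T n)).
have H := fubini_tonelli1 (m1 := D) (m2 := iid D n) f mf (fun w => prod0 _ _).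
etransitivity; first exact: H.
transitivity (\int[D]_z ((h z)%:E * (\int[D]_z (h z)%:E) ^+ n))%E.
  apply: eq_integral => z _; rewrite /fubini_F -ih.
  under eq_integral do rewrite fE /=.
  rewrite ge0_integralZl_EFin //.
    by move=> S _; exact: prod0.
  exact: mprod.
rewrite ge0_integralZr //.
- by rewrite expeS.
- exact/measurable_EFinP.
- by move=> z _; rewrite lee_fin.
- by apply: expe_ge0; apply: integral_ge0 => z _; rewrite lee_fin.
Qed.

(** * Exponential moments and the union bound *)

(** After multiplication by [1 - x], the left side is at most 1 because e^(-x) >= 1 - x, and the
    right side is 1 + x^2 (1 - 2x) >= 1. *)
Lemma expR_le_quadratic (R : realType) (x : R) :
  `|x| <= 1 / 2 -> expR x <= 1 + x + 2 * x ^+ 2.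
Proof.
rewrite ler_norml => /andP[x1 x2].
have e0 := expR_gt0 x.
have e1 : expR x * (1 - x) <= 1.
  rewrite -[leRHS](expRxMexpNx_1 x) ler_pM2l //.
  by have := expR_ge1Dx (- x).
have y0 : 0 < 1 - x by lra.
rewrite -(ler_pM2r y0) (le_trans e1) //.
have -> : (1 + x + 2 * x ^+ 2) * (1 - x) = 1 + x ^+ 2 * (1 - 2 * x) by ring.
by rewrite lerDl mulr_ge0 ?sqr_ge0 //; lra.
Qed.

(** The [f i] are bounded only on the full-measure set [A], hence the integrals over [A]. The finite
    index serves one variable (exponential moment), all matrix entries (risk), or none (risk at most
    1). *)
Lemma le_integral_affine (R : realType) (d : measure_display)
    (T : measurableType d) (P : probability T R) (A : set T) (I : finType)
    (f : I -> T -> R) (B a : R) (b : I -> R) (h : T -> R) :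
  measurable A -> P A = 1%E ->
  (forall i, measurable_fun setT (f i)) ->
  (forall i z, A z -> `|f i z| <= B) ->
  measurable_fun setT h -> (forall z, 0 <= h z) ->
  (forall z, A z -> h z <= a + \sum_i b i * f i z) ->
  (\int[P]_z (h z)%:E <=
   (a + \sum_i b i * (\int[P]_(z in A) f i z)%R)%:E)%E.
Proof.
move=> mA PA mf fB mh h0 hle.
have fint i : P.-integrable A (EFin \o f i).
  apply: measurable_bounded_integrable => //.
  - by apply: (@le_lt_trans _ _ 1%E); rewrite ?ltry //; exact: probability_le1.
  - exact: measurable_funS (mf i).
  - exists B; split; first exact: num_real.
    by move=> M /ltW BM z Az; exact: le_trans (fB i z Az) BM.
have -> : (\int[P]_z (h z)%:E = \int[P]_(z in A) (h z)%:E)%E.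
  rewrite (ge0_negligible_integral (N := ~` A)) //.
  - by rewrite setTD setCK.
  - exact: measurableC.
  - exact/measurable_EFinP.
  - by move=> z _; rewrite lee_fin.
  - by rewrite [LHS]probability_setC // PA subee.
pose g z := (a%:E + \sum_i (b i)%:E * (f i z)%:E)%E.
have gE z : g z = (a + \sum_i b i * f i z)%:E.
  by rewrite EFinD -sumEFin; congr (_ + _)%E; apply: eq_bigr => i _.
have int_cst : P.-integrable A (fun=> a%:E).
  by apply: finite_measure_integrable_cst.
have int_term i : P.-integrable A (fun z => (b i)%:E * (f i z)%:E)%E.
  exact: (integrableZl mA (b i) (fint i)).
have int_sum : P.-integrable A (fun z => \sum_i (b i)%:E * (f i z)%:E)%E.
  exact: integrable_sum.
have -> : ((a + \sum_i b i * (\int[P]_(z in A) f i z)%R)%:E =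
    \int[P]_(z in A) g z)%E.
  rewrite (integralD mA int_cst int_sum) integral_cst // [X in (_ * X)%E]PA mule1.
  rewrite EFinD; congr (_ + _)%E; rewrite (integral_sum mA int_term) -sumEFin.
  apply: eq_bigr => i _; rewrite (integralZl mA (fint i)) EFinM; congr (_ * _)%E.
  exact: fineK (integrable_fin_num mA (fint i)).
apply: ge0_le_integral => //.
- by move=> z _; rewrite lee_fin.
- by apply/measurable_EFinP; exact: measurable_funS mh.
- exact: measurable_int (integrableD mA int_cst int_sum).
- by move=> z Az; rewrite gE lee_fin hle.
Qed.

(** On [E] some exp(sum_k g_i - t_i) is at least 1, so the sum of these over [i] dominates the
    indicator of [E]. By independence each has mean at most exp(n a_i - t_i) <= exp(-l). *)
Lemma chernoff_union (R : realType) (d : measure_display)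
    (T : measurableType d) (P : probability T R) (n : nat) (I : finType)
    (g : I -> T -> R) (a t : I -> R) (l : R) (E : set (n.-tuple T)) :
  (forall i, measurable_fun setT (g i)) ->
  (forall i, (\int[P]_z (expR (g i z))%:E <= (expR (a i))%:E)%E) ->
  (forall i, n%:R * a i - t i <= - l) ->
  measurable E ->
  (forall S, E S -> exists i, t i <= \sum_(k < n) g i (tnth S k)) ->
  (iid P n E <= (#|I|%:R * expR (- l))%:E)%E.
Proof.
move=> mg ga al mE Et.
pose F i (S : n.-tuple T) := \prod_(k < n) expR (g i (tnth S k)).
have mF i : measurable_fun setT (F i).
  apply: measurable_prod => k _.
  have mgk : measurable_fun setT (fun S : n.-tuple T => g i (tnth S k)).
    by apply: (measurableT_comp (mg i)); exact: measurable_tnth.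
  exact: measurableT_comp mgk.
have F0 i S : 0 <= F i S by apply: prodr_ge0 => k _; exact: expR_ge0.
have intF i : (\int[iid P n]_S (F i S)%:E <= (expR (n%:R * a i))%:E)%E.
  have mexp : measurable_fun setT (fun z => expR (g i z)).
    exact: measurableT_comp (mg i).
  have -> : (\int[iid P n]_S (F i S)%:E = (\int[P]_z (expR (g i z))%:E) ^+ n)%E.
    by apply: (integral_iid _ _ _ P n _ mexp) => z; exact: expR_ge0.
  have : (0 <= \int[P]_z (expR (g i z))%:E)%E.
    by apply: integral_ge0 => z _; rewrite lee_fin expR_ge0.
  (* Nonnegativity and the bound [ga] leave only a finite value, on which powers are monotone. *)
  move: (ga i); case: (integral _ _ _) => [r||] //=.
  rewrite !lee_fin -EFin_expe lee_fin expRM_natl => ra r0.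
  by rewrite lerXn2r // nnegrE (expR_ge0, r0).
have -> : iid P n E = (\int[iid P n]_S (\1_E S)%:E)%E by rewrite integral_indic ?setIT.
apply: (@le_trans _ _ (\int[iid P n]_S (\sum_i (expR (- t i))%:E * (F i S)%:E)))%E.
  apply: ge0_le_integral => //.
  - apply/measurable_EFinP; exact: measurable_indic.
  - apply: emeasurable_sum => i; apply/measurable_EFinP.
    by apply: measurable_funM => //; exact: mF.
  - move=> S _; under eq_bigr do rewrite -EFinM; rewrite sumEFin lee_fin indicE.
    have [|_] := boolP (S \in E); last first.
      by apply: sumr_ge0 => i _; rewrite mulr_ge0 ?expR_ge0.
    rewrite inE => /Et[i ti]; rewrite (bigD1 i) //= ler_wpDr //.
      by apply: sumr_ge0 => j _; rewrite mulr_ge0 ?expR_ge0.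
    by rewrite /F -expR_sum -expRD -[X in X <= _]expR0 ler_expR addrC subr_ge0.
rewrite ge0_integral_sum //; last 2 first.
- move=> i; apply/measurable_EFinP; apply: measurable_funM => //; exact: mF.
- by move=> i S _; rewrite mule_ge0 // lee_fin ?expR_ge0.
rewrite mulr_natl -sumr_const -sumEFin.
apply: lee_sum => i _; rewrite ge0_integralZl_EFin ?expR_ge0 //; last 2 first.
- by move=> S _; rewrite lee_fin.
- exact/measurable_EFinP.
apply: le_trans (lee_wpmul2l _ (intF i)) _; first by rewrite lee_fin expR_ge0.
by rewrite -EFinM lee_fin -expRD ler_expR addrC.
Qed.

(** * Cauchy-Schwarz and the Frobenius norm *)

Lemma sum_sqr_ge0 (R : realType) (I : finType) (u : I -> R) :
  0 <= \sum_i u i ^+ 2.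
Proof. by apply: sumr_ge0 => i _; exact: sqr_ge0. Qed.

(** The sum of the squares (A v_i - B u_i)^2 equals A (A V - B^2). Divide by [A] if it is positive;
    if it is 0, every [u i] vanishes. *)
Lemma sum_cauchy_schwarz (R : realType) (I : finType) (u v : I -> R) :
  (\sum_i u i * v i) ^+ 2 <= (\sum_i u i ^+ 2) * (\sum_i v i ^+ 2).
Proof.
set A := \sum_i u i ^+ 2; set B := \sum_i u i * v i; set V := \sum_i v i ^+ 2.
have A0 : 0 <= A by exact: sum_sqr_ge0.
have AV : 0 <= A * (A * V - B ^+ 2).
  have -> : A * (A * V - B ^+ 2) = \sum_i (A * v i - B * u i) ^+ 2.
    transitivity (\sum_i (A ^+ 2 * v i ^+ 2 - 2 * A * B * (u i * v i)
        + B ^+ 2 * u i ^+ 2)); last by apply: eq_bigr => i _; ring.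
    rewrite big_split sumrB /= -!mulr_sumr -/A -/B -/V; ring.
  exact: sum_sqr_ge0.
move: A0; rewrite le0r => /predU1P[A0|A0]; last first.
  by move: AV; rewrite pmulr_rge0 // subr_ge0.
have u0 i : u i = 0.
  apply/eqP; rewrite -sqrf_eq0; move/eqP: A0; rewrite psumr_eq0.
    by move=> /allP /(_ i); rewrite mem_index_enum => /(_ isT).
  by move=> j _; exact: sqr_ge0.
by rewrite A0 mul0r /B big1 ?expr0n // => i _; rewrite u0 mul0r.
Qed.

Lemma dot_le (R : realType) (I : finType) (u v : I -> R) (q r : R) :
  0 <= q -> 0 <= r -> \sum_i u i ^+ 2 <= q ^+ 2 -> \sum_i v i ^+ 2 <= r ^+ 2 ->
  \sum_i u i * v i <= q * r.
Proof.
move=> q0 r0 uq vr; rewrite (le_trans (ler_norm _)) // -sqrtr_sqr.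
rewrite -(ger0_norm (mulr_ge0 q0 r0)) -sqrtr_sqr ler_wsqrtr // exprMn.
rewrite (le_trans (sum_cauchy_schwarz _ _ u v)) // ler_pM ?sum_sqr_ge0 //.
Qed.

Lemma frobenius_ge0 (R : realType) m n (A : 'M[R]_(m, n)) : 0 <= frobenius A.
Proof. exact: sqrtr_ge0. Qed.

Lemma frobenius_sqr (R : realType) m n (A : 'M[R]_(m, n)) :
  frobenius A ^+ 2 = \sum_(u : 'I_m * 'I_n) A u.1 u.2 ^+ 2.
Proof.
rewrite /frobenius sqr_sqrtr; last by apply: sumr_ge0 => i _; exact: sum_sqr_ge0.
by rewrite pair_bigA.
Qed.

Lemma frobenius_col_sqr (R : realType) n (x : 'cV[R]_n) :
  frobenius x ^+ 2 = \sum_j x j ord0 ^+ 2.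
Proof.
rewrite /frobenius sqr_sqrtr; last by apply: sumr_ge0 => i _; exact: sum_sqr_ge0.
by apply: eq_bigr => j _; rewrite big_ord1.
Qed.

Lemma frobenius_mulmx_col (R : realType) m n (A : 'M[R]_(m, n)) (x : 'cV[R]_n) :
  \sum_k (A *m x) k ord0 ^+ 2 <= (frobenius A * frobenius x) ^+ 2.
Proof.
rewrite exprMn frobenius_sqr frobenius_col_sqr.
rewrite -(pair_bigA _ (fun k j => A k j ^+ 2)) /= mulr_suml.
by apply: ler_sum => k _; rewrite mxE sum_cauchy_schwarz.
Qed.

Lemma norm_coord_frobenius (R : realType) n (x : 'cV[R]_n) j :
  `|x j ord0| <= frobenius x.
Proof.
rewrite -(ger0_norm (frobenius_ge0 _ _ _ x)) -ler_sqr ?nnegrE //.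
rewrite !real_normK ?num_real // frobenius_col_sqr (bigD1 j) //= lerDl.
by apply: sumr_ge0 => i _; exact: sqr_ge0.
Qed.

(** * The label vectors and the 0-1 loss *)

Lemma sum_eq_mul (R : realType) (I : finType) (y : I) (g : I -> R) :
  \sum_k (k == y)%:R * g k = g y.
Proof.
rewrite (bigD1 y) //= eqxx mul1r big1 ?addr0 // => k /negbTE ->.
by rewrite mul0r.
Qed.

Lemma label_vec_norm (R : realType) (c : nat) (y : 'I_c.+1) :
  \sum_k (@label_vec R c.+1 y k ord0) ^+ 2 = (c.+1%:R - 1) / c.+1%:R.
Proof.
have c0 : c.+1%:R != 0 :> R by rewrite pnatr_eq0.
transitivity (\sum_k ((k == y)%:R * (1 - 2 / c.+1%:R)
    + (c.+1%:R ^- 2 : R))).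
  apply: eq_bigr => k _; rewrite label_vecE; move: (c.+1%:R) c0 => N N0.
  by case: (k == y) => /=; field.
rewrite big_split /= sum_eq_mul sumr_const card_ord -[X in _ + X]mulr_natl.
by move: (c.+1%:R) c0 => N N0; field.
Qed.

(* [(e_y + e_k) / 2 - 1 / C] is the projection of [label_vec y] on the
   half-space [z y <= z k]. *)
Lemma label_vec_dot_le (R : realType) (c : nat) (z : 'cV[R]_c.+1) (r : R)
    (y k : 'I_c.+1) :
  0 <= r -> \sum_l z l ord0 ^+ 2 <= r ^+ 2 -> k != y -> z y ord0 <= z k ord0 ->
  \sum_l label_vec y l ord0 * z l ord0
    <= Num.sqrt ((c.+1%:R - 2) / (2 * c.+1%:R)) * r.
Proof.
move=> r0 zr ky zyk.
have c0 : c.+1%:R != 0 :> R by rewrite pnatr_eq0.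
have c2 : 2 <= c.+1%:R :> R.
  by rewrite ler_nat ltnS lt0n; apply: contra ky => /eqP c_eq0; subst c; rewrite !ord1.
pose v (l : 'I_c.+1) : R := ((l == y)%:R + (l == k)%:R) / 2 - c.+1%:R^-1.
have vE : \sum_l v l ^+ 2 = (c.+1%:R - 2) / (2 * c.+1%:R).
  transitivity (\sum_l ((l == y)%:R * (1 / 4 - c.+1%:R^-1)
      + (l == k)%:R * (1 / 4 - c.+1%:R^-1) + (c.+1%:R ^- 2 : R))).
    apply: eq_bigr => l _; rewrite /v; move: (c.+1%:R) c0 => N N0; have [->|_] := eqVneq l y.
      by rewrite eq_sym (negbTE ky) /=; field.
    by case: (l == k) => /=; field.
  rewrite !big_split /= !sum_eq_mul sumr_const card_ord -[X in _ + X]mulr_natl.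
  by move: (c.+1%:R) c0 => N N0; field.
apply: (@le_trans _ _ (\sum_l v l * z l ord0)).
  rewrite -subr_ge0 -sumrB.
  (* [v] minus the label vector is (e_k - e_y) / 2, so the products differ by (z_k - z_y) / 2 >=
     0. *)
  have -> : \sum_l (v l * z l ord0 - label_vec y l ord0 * z l ord0) =
      \sum_l ((l == k)%:R * (z l ord0 / 2) - (l == y)%:R * (z l ord0 / 2)).
    by apply: eq_bigr => l _; rewrite label_vecE /v; field.
  rewrite sumrB !sum_eq_mul; lra.
apply: dot_le => //.
rewrite sqr_sqrtr ?vE // divr_ge0 ?mulr_ge0 ?ler0n //; lra.
Qed.

(** With b_C = 1 / (1 - sigma), the bracket is at least 1 - sigma when the loss is 1, by
    [label_vec_dot_le], and at least 0 otherwise, by Cauchy-Schwarz. As [r] is a bound on |z| rather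
    than |z| itself, the right side is affine in [z]. *)
Lemma loss01_le (R : realType) (c : nat) (z : 'cV[R]_c.+1) (r : R)
    (y : 'I_c.+1) :
  (2 < c.+1)%N -> 0 < r -> \sum_l z l ord0 ^+ 2 <= r ^+ 2 ->
  loss01 z y <= b_ R c.+1 * (1 - Num.sqrt (c.+1%:R / (c.+1%:R - 1))
     * ((\sum_l label_vec y l ord0 * z l ord0) / r)).
Proof.
move=> c3 r0 zr; set s := \sum_l _.
have cR : 3 <= c.+1%:R :> R by rewrite ler_nat.
set a := Num.sqrt (c.+1%:R / _); rewrite /b_.
set sg := Num.sqrt ((c.+1%:R - 2) / _).
have a0 : 0 <= a by exact: sqrtr_ge0.
have sg1 : 0 < 1 - sg.
  rewrite subr_gt0 -[ltRHS]sqrtr1 ltr_sqrt // ltr_pdivrMr; lra.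
rewrite mulrC mulrA mulr1 ler_pdivlMr // /loss01.
case: existsP => [[k /andP[ky zyk]]|_]; rewrite ?mul0r ?mul1r.
  rewrite lerD2l lerN2.
  apply: (@le_trans _ _ (a * Num.sqrt ((c.+1%:R - 2) / (2 * c.+1%:R)))).
    rewrite ler_wpM2l // ler_pdivrMr //.
    exact: label_vec_dot_le (ltW r0) zr ky zyk.
  (* The product of sqrt(C / (C - 1)) and sqrt((C - 2) / (2 C)) is sigma. *)
  rewrite -sqrtrM ?divr_ge0; [|lra..].
  by rewrite le_eqVlt; apply/orP; left; apply/eqP; congr Num.sqrt; field; lra.
rewrite subr_ge0.
(* [a] is the inverse of |c_y|. *)
apply: (@le_trans _ _ (a * Num.sqrt ((c.+1%:R - 1) / c.+1%:R))).
  rewrite ler_wpM2l // ler_pdivrMr //; apply: dot_le => //.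
  - exact: ltW.
  - rewrite sqr_sqrtr ?label_vec_norm // divr_ge0; lra.
rewrite -sqrtrM ?divr_ge0; [|lra..].
rewrite -[leRHS]sqrtr1 ler_wsqrtr // le_eqVlt; apply/orP; left; apply/eqP; field; lra.
Qed.

(** * Entries of c_y x^T under label noise *)

Lemma norm_contrib_le (R : realType) (c d : nat) (M : R) (x : 'cV[R]_d) y k j :
  frobenius x <= M -> `|contrib R c.+1 d k j (x, y)| <= M.
Proof.
move=> xM; rewrite /contrib normrM -[leRHS]mul1r ler_pM //=; last first.
  exact: le_trans (norm_coord_frobenius _ _ _ _) xM.
rewrite label_vecE; have c0 : 0 < c.+1%:R^-1 :> R by rewrite invr_gt0 ltr0n.
have c1 : c.+1%:R^-1 <= 1 :> R by rewrite invf_le1 ?ltr0n // ler1n.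
by move: (c.+1%:R^-1) c0 c1 => i i0 i1; case: (k == y); rewrite ler_norml /=; lra.
Qed.

(** The vectors c_y sum to 0, so a uniformly redrawn label adds nothing to the mean; hence the
    factor 1 - p. *)
Lemma sum_contrib (R : realType) (c d : nat) (x : 'cV[R]_d) k j :
  \sum_y contrib R c.+1 d k j (x, y) = 0.
Proof.
rewrite /contrib -mulr_suml /=.
have -> : \sum_y @label_vec R c.+1 y k ord0 = 0; last by rewrite mul0r.
under eq_bigr => y _ do rewrite label_vecE eq_sym -[(y == k)%:R]mulr1.
rewrite sumrB sum_eq_mul sumr_const card_ord -[X in _ - X]mulr_natl.
by rewrite divff ?subrr // pnatr_eq0.
Qed.

(** In the quadratic bound on the exponential, the linear term survives only with the weight 1 - p
    of a kept label, while the second-order term is at most 2 s^2 M^2 for every label. *)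
Lemma noisy_contrib_mgf (R : realType) (c d : nat) (M p s : R)
    (X : set 'cV[R]_d) (D : probability ('cV[R]_d * 'I_c.+1)%type R) k j :
  measurable X -> (forall x, X x -> frobenius x <= M) ->
  D (X `*` setT) = 1%E -> 0 <= p <= 1 -> `|s| * M <= 1 / 2 ->
  (\int[noisy p D]_z (expR (s * contrib R c.+1 d k j z))%:E <=
   (expR (s * ((1 - p) * (\int[D]_(z in X `*` setT) contrib R c.+1 d k j z)%R)
          + 2 * s ^+ 2 * M ^+ 2))%:E)%E.
Proof.
move=> mX XM DX p01 sM; have [p0 p1] := andP p01.
pose f := contrib R c.+1 d k j.
have mf : measurable_fun setT f by exact: measurable_contrib.
have mexp : measurable_fun setT (fun z => expR (s * f z)).
  by apply: measurableT_comp => //; apply: measurable_funM.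
have mexpy (y : 'I_c.+1) : measurable_fun setT
    (fun z : 'cV[R]_d * 'I_c.+1 => expR (s * f (z.1, y))).
  by apply: (measurableT_comp mexp); apply: measurable_fun_pair.
rewrite integral_noisy //.
have fM x y : X x -> `|f (x, y)| <= M.
  by move=> Xx; apply: norm_contrib_le; exact: XM.
have quad x y : X x ->
    expR (s * f (x, y)) <= 1 + s * f (x, y) + 2 * s ^+ 2 * M ^+ 2.
  move=> Xx; have fb := fM x y Xx.
  apply: le_trans (expR_le_quadratic _ _ _) _.
    by rewrite normrM (le_trans _ sM) // ler_wpM2l.
  have fM2 : f (x, y) ^+ 2 <= M ^+ 2.
    by rewrite -real_normK ?num_real // lerXn2r ?nnegrE ?(le_trans _ fb).
  by rewrite lerD2l exprMn mulrA ler_wpM2l // mulr_ge0 ?sqr_ge0.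
have H := le_integral_affine _ _ _ D (X `*` setT) 'I_1 (fun=> f) M
  (1 + 2 * s ^+ 2 * M ^+ 2) (fun=> s * (1 - p)).
apply: le_trans (H _ _ _ _ _ _ _ _) _ => {H} //.
- exact: measurableX.
- by move=> _ [x y] [/= Xx _]; exact: fM.
- apply: measurable_funD; apply: measurable_funM => //.
  by apply: measurable_funM => //; apply: measurable_sum.
- move=> z; apply: addr_ge0; apply: mulr_ge0; rewrite ?subr_ge0 ?expR_ge0 //.
  by apply: mulr_ge0; rewrite ?invr_ge0 //; apply: sumr_ge0 => y _; exact: expR_ge0.
- move=> [x y] [/= Xx _]; rewrite big_ord1.
  have avg : c.+1%:R^-1 * \sum_y' expR (s * f (x, y')) <= 1 + 2 * s ^+ 2 * M ^+ 2.
    have -> : 1 + 2 * s ^+ 2 * M ^+ 2 = c.+1%:R^-1 *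
        \sum_y' ((1 + 2 * s ^+ 2 * M ^+ 2) + s * f (x, y')).
      rewrite big_split /= -mulr_sumr sum_contrib mulr0 addr0 sumr_const card_ord.
      by rewrite -[(_ + _) *+ _]mulr_natl mulKf ?pnatr_eq0.
    rewrite ler_wpM2l ?invr_ge0 // ler_sum // => y' _.
    by rewrite addrAC; exact: quad.
  have q := quad x y Xx.
  have p1' : 0 <= 1 - p by rewrite subr_ge0.
  apply: le_trans (lerD (ler_wpM2l p1' q) (ler_wpM2l p0 avg)) _.
  by rewrite le_eqVlt; apply/orP; left; apply/eqP; ring.
(* 1 + u <= exp(u) gives a form that multiplies well over [n] draws. *)
rewrite lee_fin big_ord1 (le_trans _ (expR_ge1Dx _)) //.
by rewrite le_eqVlt; apply/orP; left; apply/eqP; ring.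
Qed.

(** * The risk of a fixed matrix, and the concentration of the sample mean *)

(** [loss01_le] at z = W x with r = |W| M is affine in the entries of c_y x^T, since <c_y, W x> =
    <W, c_y x^T>, and so it can be integrated. [W] is nonzero to make [r] positive. *)
Lemma risk01_le (R : realType) (c d : nat) (M : R)
    (X : set 'cV[R]_d) (D : probability ('cV[R]_d * 'I_c.+1)%type R)
    (W : 'M[R]_(c.+1, d)) :
  (2 < c.+1)%N -> 0 < M ->
  measurable X -> (forall x, X x -> frobenius x <= M) ->
  D (X `*` setT) = 1%E -> 0 < frobenius W ->
  (risk01 D W <= (b_ R c.+1 * (1 - Num.sqrt (c.+1%:R / (c.+1%:R - 1)) *
     ((\sum_(u : 'I_c.+1 * 'I_d) W u.1 u.2 *
        (\int[D]_(z in X `*` setT) contrib R c.+1 d u.1 u.2 z)%R)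
      / (frobenius W * M))))%:E)%E.
Proof.
move=> c3 M0 mX XM DX W0; rewrite /risk01 unlock.
set a := Num.sqrt _; set w := frobenius W.
have wM0 : 0 < w * M by exact: mulr_gt0.
pose K := b_ R c.+1 * a / (w * M).
have -> : b_ R c.+1 * (1 - a * ((\sum_(u : 'I_c.+1 * 'I_d) W u.1 u.2 *
        (\int[D]_(z in X `*` setT) contrib R c.+1 d u.1 u.2 z)%R) / (w * M))) =
  b_ R c.+1 + \sum_(u : 'I_c.+1 * 'I_d) (- (K * W u.1 u.2))
    * (\int[D]_(z in X `*` setT) contrib R c.+1 d u.1 u.2 z)%R.
  under [X in _ = _ + X]eq_bigr do rewrite mulNr -mulrA.
  by rewrite sumrN -mulr_sumr /K; ring.
apply: (le_integral_affine _ _ _ _ _ _ _ M) => //.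
- exact: measurableX.
- by move=> u; exact: measurable_contrib.
- by move=> u [x y] [/= Xx _]; apply: norm_contrib_le; exact: XM.
- by apply: measurable_loss01.
- move=> [x y] [/= Xx _].
  have zr : \sum_l (W *m x) l ord0 ^+ 2 <= (w * M) ^+ 2.
    apply: le_trans (frobenius_mulmx_col _ _ _ W x) _.
    rewrite lerXn2r ?nnegrE ?mulr_ge0 ?frobenius_ge0 ?(ltW M0) //.
    by rewrite ler_wpM2l ?frobenius_ge0 ?XM.
  apply: le_trans (loss01_le _ _ _ _ y c3 wM0 zr) _.
  under [X in _ <= _ + X]eq_bigr do rewrite mulNr -mulrA.
  rewrite sumrN -mulr_sumr -/a /K.
  have -> : \sum_l label_vec y l ord0 * (W *m x) l ord0 =
      \sum_(u : 'I_c.+1 * 'I_d) W u.1 u.2 * contrib R c.+1 d u.1 u.2 (x, y).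
    rewrite -(pair_bigA _ (fun k j => W k j * contrib R c.+1 d k j (x, y))) /=.
    apply: eq_bigr => k _; rewrite [(W *m x) k ord0]mxE mulr_sumr; apply: eq_bigr => j _.
    by rewrite /contrib /= mulrCA.
  by rewrite le_eqVlt; apply/orP; left; apply/eqP; ring.
Qed.

(** The union bound runs over the C d entries and the two signs of the deviation, whence the factor
    2 C d. *)
Lemma mu_unh_concentration (R : realType) (c d n : nat) (M p l eps : R)
    (X : set 'cV[R]_d) (D : probability ('cV[R]_d * 'I_c.+1)%type R)
    (E : set (n.-tuple ('cV[R]_d * 'I_c.+1))) :
  (0 < n)%N -> 0 < M -> measurable X -> (forall x, X x -> frobenius x <= M) ->
  D (X `*` setT) = 1%E -> 0 <= p <= 1 ->
  2 * M * (l + 1 / 2) <= eps * Num.sqrt n%:R ->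
  measurable E ->
  (forall S, E S -> exists k j, eps < `|mu_unh S k j
     - (1 - p) * (\int[D]_(z in X `*` setT) contrib R c.+1 d k j z)%R|) ->
  (iid (noisy p D) n E <= (2 * (c.+1%:R * d%:R) * expR (- l))%:E)%E.
Proof.
move=> n0 M0 mX XM DX p01 epsl mE hE.
set sn := Num.sqrt _ in epsl.
have sn0 : 0 < sn by rewrite sqrtr_gt0 ltr0n.
have snsn : n%:R = sn ^+ 2 by rewrite sqr_sqrtr // ler0n.
have sn1 : 1 <= sn by rewrite -[leLHS]sqrtr1 ler_wsqrtr // ler1n.
(* This exponent does not depend on [l]; the price is a full logarithm, instead
   of its square root, in the deviation. *)
pose lam : R := (2 * M * sn)^-1.
have lam0 : 0 < lam by rewrite invr_gt0 !mulr_gt0.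
pose m (u : 'I_c.+1 * 'I_d) : R :=
  (1 - p) * (\int[D]_(z in X `*` setT) contrib R c.+1 d u.1 u.2 z)%R.
(* The boolean is the sign of the deviation: [false] for an entry that is too large, [true] for one
   that is too small. *)
pose s (i : ('I_c.+1 * 'I_d) * bool) : R := (-1) ^+ i.2 * lam.
have s2 i : s i ^+ 2 = lam ^+ 2 by rewrite exprMn sqrr_sign mul1r.
have -> : 2 * (c.+1%:R * d%:R) = #|{: ('I_c.+1 * 'I_d) * bool}|%:R :> R.
  by rewrite !card_prod !card_ord card_bool !natrM mulrC.
apply: (chernoff_union _ _ _ _ _ _ (fun i z => s i * contrib R c.+1 d i.1.1 i.1.2 z)
  (fun i => s i * m i.1 + 2 * s i ^+ 2 * M ^+ 2)
  (fun i => n%:R * (s i * m i.1 + lam * eps))) => //.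
- by move=> i; apply: measurable_funM => //; exact: measurable_contrib.
- move=> i; apply: noisy_contrib_mgf => //.
  rewrite /s normrM normr_sign !mul1r gtr0_norm // /lam.
  rewrite ler_pdivrMl ?mulr_gt0 //; nra.
- move=> i; rewrite s2 snsn.
  (* Since n lam^2 M^2 = 1/4, the quadratic terms add up to 1/2 over the sample; this is the 1/2
     added to [l] in the hypothesis on [eps]. *)
  have -> : sn ^+ 2 * (s i * m i.1 + 2 * lam ^+ 2 * M ^+ 2) -
      sn ^+ 2 * (s i * m i.1 + lam * eps) = 1 / 2 - eps * sn / (2 * M).
    rewrite /lam; field; by rewrite !gt_eqF.
  have : l + 1 / 2 <= eps * sn / (2 * M).
    by rewrite ler_pdivlMr ?mulr_gt0 // mulrC.
  lra.
- move=> S /hE[k [j]]; rewrite lter_normr => /orP[h|h].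
  + exists ((k, j), false); rewrite -mulr_sumr /s /= expr0 mul1r.
    have -> : \sum_(i < n) contrib R c.+1 d k j (tnth S i) = n%:R * mu_unh S k j.
      by rewrite mu_unhE mulrA divff ?mul1r // pnatr_eq0 -lt0n.
    rewrite -subr_ge0 (_ : _ - _ =
      n%:R * lam * ((mu_unh S k j - m (k, j)) - eps)); last ring.
    by rewrite mulr_ge0 ?subr_ge0 ?(ltW h) // mulr_ge0 ?ler0n // ltW.
  + exists ((k, j), true); rewrite -mulr_sumr /s /= expr1 mulN1r.
    have -> : \sum_(i < n) contrib R c.+1 d k j (tnth S i) = n%:R * mu_unh S k j.
      by rewrite mu_unhE mulrA divff ?mul1r // pnatr_eq0 -lt0n.
    rewrite -subr_ge0 (_ : _ - _ =
      n%:R * lam * (- (mu_unh S k j - m (k, j)) - eps)); last ring.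
    by rewrite mulr_ge0 ?subr_ge0 ?(ltW h) // mulr_ge0 ?ler0n // ltW.
Qed.

(** * The risk of a matrix close to the noisy mean *)

(** Covers the zero matrix, which [risk01_le] excludes. *)
Lemma risk01_le1 (R : realType) (c d : nat)
    (D : probability ('cV[R]_d * 'I_c.+1)%type R) (W : 'M[R]_(c.+1, d)) :
  (risk01 D W <= 1)%E.
Proof.
rewrite /risk01 unlock.
have H := le_integral_affine _ _ _ D setT 'I_0 (fun=> cst 0) 0 1 (fun=> 0)
  (fun z => loss01 (W *m z.1) z.2).
apply: le_trans (H _ _ _ _ _ _ _) _ => {H} //.
- exact: probability_setT.
- by case.
- exact: measurable_loss01.
- by move=> z _; rewrite big_ord0 addr0 /loss01; case: [exists _, _].
- by rewrite big_ord0 addr0.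
Qed.

Lemma b_ge1 (R : realType) (C : nat) : (2 < C)%N -> 1 <= b_ R C.
Proof.
move=> C3; rewrite /b_; set sg := Num.sqrt _.
have cR : 3 <= C%:R :> R by rewrite ler_nat.
have sg0 : 0 <= sg by exact: sqrtr_ge0.
have sg1 : 0 < 1 - sg.
  rewrite subr_gt0 -[ltRHS]sqrtr1 ltr_sqrt // ltr_pdivrMr; lra.
by rewrite ler_pdivlMr // mul1r; lra.
Qed.

(** Entrywise distance [eps] gives Frobenius distance at most sqrt(d C) eps, so <W, E_D c_y x^T> is
    at least (|W|^2 - |W| sqrt(d C) eps) / (1 - p); this goes into [risk01_le]. *)
Lemma risk01_le_of_close (R : realType) (c d : nat) (M p eps : R)
    (X : set 'cV[R]_d) (D : probability ('cV[R]_d * 'I_c.+1)%type R)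
    (W : 'M[R]_(c.+1, d)) :
  (2 < c.+1)%N -> 0 < M -> 0 <= p < 1 ->
  measurable X -> (forall x, X x -> frobenius x <= M) ->
  D (X `*` setT) = 1%E -> 0 <= eps ->
  (forall k j, `|W k j
     - (1 - p) * (\int[D]_(z in X `*` setT) contrib R c.+1 d k j z)%R| <= eps) ->
  (risk01 D W <= (b_ R c.+1 * (1 - Num.sqrt (c.+1%:R / (c.+1%:R - 1)) *
     (frobenius W / ((1 - p) * M)))
     + b_ R c.+1 * (2 * (Num.sqrt (d%:R * c.+1%:R) * eps / ((1 - p) * M))))%:E)%E.
Proof.
move=> c3 M0 /andP[p0 p1] mX XM DX eps0 Wm.
have b1 := b_ge1 R _ c3; set b := b_ R c.+1 in b1 *.
set a := Num.sqrt (c.+1%:R / _); set sdc := Num.sqrt (d%:R * _).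
have a0 : 0 <= a by exact: sqrtr_ge0.
have cR : 3 <= c.+1%:R :> R by rewrite ler_nat.
(* A crude bound, and the source of the factor 2 in the error term. *)
have a2 : a <= 2.
  rewrite -[leRHS]ger0_norm // -sqrtr_sqr ler_wsqrtr // ler_pdivrMr; lra.
have sdc0 : 0 <= sdc by exact: sqrtr_ge0.
have q0 : 0 < 1 - p by lra.
have qM0 : 0 < (1 - p) * M by exact: mulr_gt0.
have h0 : 0 <= sdc * eps / ((1 - p) * M).
  by rewrite divr_ge0 ?(ltW qM0) // mulr_ge0.
have b0 : 0 <= b by lra.
have : 0 <= frobenius W by exact: frobenius_ge0.
rewrite le0r => /predU1P[W0|W0].
  (* For W = 0 the bracket equals 1, and b_C >= 1 bounds any risk. *)
  apply: le_trans (risk01_le1 _ _ _ D W) _; rewrite W0 mul0r mulr0 subr0 mulr1 lee_fin.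
  by rewrite (le_trans b1) // lerDl mulr_ge0 // mulr_ge0.
apply: le_trans (risk01_le _ _ _ M X D W c3 M0 mX XM DX W0) _.
rewrite lee_fin -/a -/b; set w := frobenius W in W0 *.
set t := \sum_u _.
have tE : w ^+ 2 - w * (sdc * eps) <= (1 - p) * t.
  pose m (u : 'I_c.+1 * 'I_d) : R :=
    (1 - p) * (\int[D]_(z in X `*` setT) contrib R c.+1 d u.1 u.2 z)%R.
  have -> : (1 - p) * t = w ^+ 2 -
      \sum_(u : 'I_c.+1 * 'I_d) W u.1 u.2 * (W u.1 u.2 - m u).
    rewrite frobenius_sqr -sumrB mulr_sumr; apply: eq_bigr => u _.
    by rewrite /m; ring.
  rewrite lerD2l lerN2; apply: dot_le; rewrite ?(ltW W0) ?mulr_ge0 //.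
    by rewrite frobenius_sqr.
  rewrite exprMn sqr_sqrtr ?mulr_ge0 ?ler0n //.
  apply: (@le_trans _ _ (\sum_(u : 'I_c.+1 * 'I_d) eps ^+ 2)).
    by apply: ler_sum => u _; rewrite -real_normK ?num_real // lerXn2r ?nnegrE //.
  by rewrite sumr_const card_prod !card_ord -[eps ^+ 2 *+ _]mulr_natl natrM [d%:R * _]mulrC.
have key : w / ((1 - p) * M) - sdc * eps / ((1 - p) * M) <= t / (w * M).
  rewrite -mulrBl ler_pdivrMr // mulrAC ler_pdivlMr ?mulr_gt0 //.
  have := ler_wpM2r (ltW M0) tE; lra.
rewrite -mulrDr ler_wpM2l //.
have := ler_wpM2l a0 key; have := ler_wpM2r h0 a2; lra.
Qed.

(** * Choice of the deviation and probability of failure *)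

Theorem proposition4p4 (R : realType) :
  exists (K : R) (r : nat),
  forall (c d n : nat) (M p delta : R) (X : set 'cV[R]_d)
    (D : probability ('cV[R]_d * 'I_c.+1)%type R),
  let C := c.+1 in
  (2 < C)%N -> (0 < d)%N -> (0 < n)%N -> 0 < M ->
  0 <= p < 1 -> 0 < delta <= 1 ->
  measurable X -> (forall x, X x -> frobenius x <= M) ->
  D (X `*` setT) = 1%E ->
  let logfactor := 1 + ln (n%:R * d%:R * C%:R / delta) in
  let bound (S : n.-tuple ('cV[R]_d * 'I_C)) : R :=
    b_ R C * (1 - Num.sqrt (C%:R / (C%:R - 1))
                  * (frobenius (mu_unh S) / ((1 - p) * M)))
    + K * (b_ R C * Num.sqrt (d%:R * C%:R) / ((1 - p) * Num.sqrt n%:R))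
        * logfactor ^+ r in
  let good : set (n.-tuple ('cV[R]_d * 'I_C)) :=
    [set S | (risk01 D (mu_unh S) <= (bound S)%:E)%E] in
  measurable good /\ ((1 - delta)%:E <= iid (noisy p D) n good)%E.
Proof.
(* 8 is the 2 of [risk01_le_of_close] times the 4 in [eps] below; one logarithm suffices. *)
exists 8, 1%N => c d n M p delta X D C c3 d0 n0 M0 p01 /andP[de0 de1] mX XM DX L.
move=> bound good.
have p01' : 0 <= p <= 1 by case/andP: p01 => -> /ltW ->.
have mgood : measurable good.
  have mb : measurable_fun setT (fun S => (bound S)%:E).
    apply/measurable_EFinP; apply: measurable_funD => //.
    apply: measurable_funM => //; apply: measurable_funB => //.
    apply: measurable_funM => //; apply: measurable_funM => //.
    exact: measurable_frobenius_mu_unh.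
  have mg := measurable_fun_lee (measurable_risk01_mu_unh R c d n D) mb.
  by rewrite -[good]setTI; have := mg measurableT; move=> /(_ [set true] I).
split=> //.
(* Equality in the hypothesis of [mu_unh_concentration] for l = 2 L - 1/2. *)
pose eps : R := 4 * M * L / Num.sqrt n%:R.
have sn0 : 0 < Num.sqrt n%:R :> R by rewrite sqrtr_gt0 ltr0n.
pose N : R := n%:R * d%:R * C%:R.
have N0 : 0 < N by rewrite !mulr_gt0 ?ltr0n.
have Nde : 1 <= N / delta.
  rewrite ler_pdivlMr // mul1r (le_trans de1) // /N -!natrM ler1n.
  by rewrite !muln_gt0 n0 d0.
have L1 : 1 <= L by rewrite lerDl ln_ge0.
pose E := [set S : n.-tuple ('cV[R]_d * 'I_c.+1) |
  [exists u : 'I_c.+1 * 'I_d, eps < `|mu_unh S u.1 u.2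
     - (1 - p) * (\int[D]_(z in X `*` setT) contrib R c.+1 d u.1 u.2 z)%R|]].
have mE : measurable E.
  have H : measurable_fun setT (fun S : n.-tuple ('cV[R]_d * 'I_c.+1) =>
    [exists u : 'I_c.+1 * 'I_d, eps < `|mu_unh S u.1 u.2
     - (1 - p) * (\int[D]_(z in X `*` setT) contrib R c.+1 d u.1 u.2 z)%R|]).
    apply: measurable_existsb => u; apply: measurable_fun_ltr => //.
    apply: measurableT_comp => //; apply: measurable_funB => //.
    exact: measurable_mu_unh.
  by rewrite -[E]setTI; have := H measurableT; move=> /(_ [set true] I).
have PE : (iid (noisy p D) n E <= delta%:E)%E.
  apply: le_trans (mu_unh_concentration R c d n M p (2 * L - 1 / 2) eps X D E
    n0 M0 mX XM DX p01' _ mE _) _.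
  - by rewrite /eps divfK ?gt_eqF //; lra.
  - by move=> S /existsP[[k j]] h; exists k, j.
  rewrite lee_fin.
  have e1 : expR (- (2 * L - 1 / 2)) <= delta / N * (1 / 2).
    (* The part L - 1 of the exponent yields delta / N; the rest, L + 1/2, yields a factor at most
       1/2 that absorbs the 2 of the two signs. *)
    have -> : - (2 * L - 1 / 2) = - ln (N / delta) + - (L + 1 / 2).
      have -> : ln (N / delta) = L - 1 by rewrite /L addrC addKr.
      by move: (L) => l; field.
    rewrite expRD expRN lnK ?posrE ?divr_gt0 // invf_div.
    apply: ler_wpM2l; first by rewrite divr_ge0 ?(ltW N0) ?(ltW de0).
    rewrite expRN div1r lef_pV2 ?posrE ?expR_gt0 //.
    by apply: le_trans (expR_ge1Dx _); lra.
  apply: le_trans (ler_wpM2l _ e1) _; first by rewrite !mulr_ge0.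
  have -> : 2 * (C%:R * d%:R) * (delta / N * (1 / 2)) = delta / n%:R.
    by rewrite /N; field; rewrite !pnatr_eq0 -!lt0n n0 d0.
  (* The failure probability is at most delta / n, hence at most [delta]. *)
  by rewrite ler_pdivrMr ?ltr0n // ler_peMr ?ler1n // ltW.
(* Off [E] every entry is within [eps] of the noisy mean, so the deterministic bound applies and its
   error term is exactly the one in [bound]. *)
have sub : ~` E `<=` good.
  move=> S /negP; rewrite negb_exists => /forallP h.
  apply: le_trans (risk01_le_of_close R c d M p eps X D (mu_unh S) c3 M0 p01 mX XM
    DX _ _) _.
  - by rewrite divr_ge0 ?(ltW sn0) // !mulr_ge0 ?(ltW M0) //; lra.
  - by move=> k j; have := h (k, j); rewrite -leNgt.
  rewrite lee_fin lerD2l expr1 /eps le_eqVlt; apply/orP; left; apply/eqP.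
  have q0 : 1 - p != 0 by case/andP: p01 => _ p1; rewrite subr_eq0 gt_eqF.
  by field; rewrite q0 !gt_eqF.
apply: (@le_trans _ _ (iid (noisy p D) n (~` E))); last first.
  by apply: le_measure => //; rewrite inE //; exact: measurableC.
by rewrite probability_setC // EFinB leeB.
Qed.
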